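(* (a) Let $K$ be a number field whose unit group $\mathcal{O}_K^\times$ has rank $r\ge1$. Then $\rho_\infty(K)\ge\frac12 R_K^{1/r}$, where $R_K$ is the regulator of $K$. (b) There exists a constant $c>0$ such that $\rho_\infty(K)\ge c$ for every number field $K$ whose unit group has rank $r\ge1$.
   Context: Let $K$ have $r_1$ real embeddings $\sigma_1,\dots,\sigma_{r_1}$ and $r_2$ pairs of complex conjugate embeddings, represented by $\sigma_{r_1+1},\dots,\sigma_{r_1+r_2}$; put $s=r_1+r_2$ and $r=s-1$ (the rank of $\mathcal{O}_K^\times$). The logarithmic embedding $\ell:K^\times\to\mathbb{R}^s$ is $\ell(x)=(\log|\sigma_1(x)|,\dots,\log|\sigma_{r_1}(x)|,2\log|\sigma_{r_1+1}(x)|,\dots,2\log|\sigma_{r_1+r_2}(x)|)$, and $\Lambda_K=\ell(\mathcal{O}_K^\times)$, a lattice of rank $r$ in $\mathbb{R}^s$. The covering radius is $\rho_\infty(K)=\sup_{v\in\mathrm{span}_{\mathbb R}(\Lambda_K)}\min_{w\in\Lambda_K}\|v-w\|_\infty$, where $\|\cdot\|_\infty$ is the sup norm on $\mathbb{R}^s$. The regulator $R_K$ is the absolute value of the determinant of any $r\times r$ submatrix of the $r\times(r+1)$ matrix with rows $\ell(u_1),\dots,\ell(u_r)$, where $u_1,\dots,u_r$ is a system of fundamental units of $K$. *)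

(* Defs.v *)
From mathcomp Require Export all_boot all_order all_algebra all_field.
From mathcomp Require Export all_classical all_reals all_analysis.
From mathcomp Require Export complex.

Set Implicit Arguments.
Unset Strict Implicit.
Unset Printing Implicit Defensive.

Import Order.TTheory GRing.Theory Num.Theory.
Import numFieldNormedType.Exports.

Local Open Scope classical_set_scope.
Local Open Scope ring_scope.
Local Open Scope complex_scope.

Section NumberField.
Variables (R : realType) (K : fieldExtType rat).

Definition integer_unit (x : K) : Prop :=
  [/\ x != 0, integralOver (intr : int -> K) x
            & integralOver (intr : int -> K) x^-1].

(* Complex embeddings are ring morphisms into [R[i]]; a real embedding is one
   with image in the real line. The first [r1] indices enumerate the real
   embeddings, the others pick one embedding in each conjugate pair. *)
Definition embedding_system (r1 r2 : nat)
    (sigma : 'I_(r1 + r2) -> {rmorphism K -> R[i]}) : Prop :=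
  [/\ forall i : 'I_(r1 + r2),
        (i < r1)%N <-> (forall x : K, sigma i x \is Num.real),
      forall i j : 'I_(r1 + r2),
        sigma i =1 sigma j \/ (forall x : K, sigma i x = (sigma j x)^*) -> i = j
    & forall tau : {rmorphism K -> R[i]},
        exists i : 'I_(r1 + r2),
          tau =1 sigma i \/ (forall x : K, tau x = (sigma i x)^*)].

Section Units.
Variables (r1 r2 : nat) (sigma : 'I_(r1 + r2) -> {rmorphism K -> R[i]}).

(* Only meaningful for [x != 0], as [ln 0 = 0] by convention. *)
Definition log_embedding (x : K) : 'rV[R]_(r1 + r2) :=
  \row_i (if (i < r1)%N then ln (ComplexField.Normc.normc (sigma i x))
          else 2 * ln (ComplexField.Normc.normc (sigma i x))).

Definition log_unit_lattice : set 'rV[R]_(r1 + r2) :=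
  log_embedding @` [set x | integer_unit x].

Definition real_span (n : nat) (A : set 'rV[R]_n) : set 'rV[R]_n :=
  [set v | exists X : seq 'rV[R]_n,
     (forall w, w \in X -> A w) /\ v \in <<X>>%VS].

(* [`|_|] on ['rV[R]_n] is the sup norm. The infimum is attained since the
   lattice is discrete, and the supremum is finite since the lattice spans. *)
Definition covering_radius : R :=
  sup [set inf [set `|v - w| | w in log_unit_lattice]
      | v in real_span log_unit_lattice].

Definition unit_rank : nat := (r1 + r2).-1.

Definition fundamental_units (u : 'I_unit_rank -> K) : Prop :=
  (forall i, integer_unit (u i)) /\
  (forall x, integer_unit x ->
     exists! p : K * {ffun 'I_unit_rank -> int},
       (exists2 n, (0 < n)%N & p.1 ^+ n = 1) /\
       x = p.1 * \prod_i u i ^ p.2 i).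

(* For a system of fundamental units this depends neither on [u] nor on the
   deleted column [j] (the coordinates of [log_embedding] of a unit sum to 0). *)
Definition regulator (u : 'I_unit_rank -> K) (j : 'I_(r1 + r2)) : R :=
  `| \det (col' j (\matrix_(i < unit_rank) log_embedding (u i))) |.

End Units.
End NumberField.

(* Main.v *)
Require Import Defs.
From HB Require Import structures.
From mathcomp Require Import ring lra zify.
Set Implicit Arguments.
Unset Strict Implicit.
Unset Printing Implicit Defensive.
Import Order.TTheory GRing.Theory Num.Theory.
Import numFieldNormedType.Exports.
Local Open Scope ring_scope.
Local Open Scope complex_scope.

(* (a) After deleting one coordinate, the boxes of radius [p] centred at the unit
   lattice cover the whole space as soon as [p] exceeds the covering radius, so
   the covolume, which is the regulator, is at most [(2 * p) ^+ r]. The covolume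
   estimate is obtained by counting classes of integer vectors modulo a large
   integer multiple of the lattice.

   (b) By Dirichlet's unit theorem the unit lattice spans the hyperplane of
   vectors with sum zero. If the covering radius is less than
   [c = ln 2 / (2 * M + 1)], choosing lattice vectors close to the points of a
   grid of mesh [2 * c] and side [M + 1] gives [(M + 1) ^ r] distinct units whose
   absolute values are all at most [2]. But distinct algebraic integers are at
   distance at least [1] at some place, so there are at most
   [81 ^ (r + 1) <= (81 ^ 2) ^ r] of these units, which is absurd for
   [M = 81 ^ 2]. *)

(** * Geometry of numbers *)

Lemma card_dffun_ord (I : finType) (n : I -> nat) :
  #|{dffun forall i : I, 'I_(n i)}| = (\prod_i n i)%N.
Proof.
rewrite card_dep_ffun foldrE big_map big_enum /=.
by apply: eq_bigr => i _; rewrite card_ord.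
Qed.

Lemma absz_unitmx_det (n : nat) (A : 'M[int]_n) :
  A \in unitmx -> `|\det A|%N = 1%N.
Proof. by rewrite unitmxE qualifE /= => /orP[] /eqP ->. Qed.

(* By the Smith normal form [B = L *m D *m R], the vectors [e *m R] with
   [0 <= e i < `|D i i|] are pairwise incongruent modulo the rows of [B]. *)
Lemma det_le_box (r T : nat) (B : 'M[int]_r) :
  (forall w : 'rV[int]_r, exists n : 'rV[int]_r,
     forall k, (`|((w - n *m B) 0 k)%R|%N <= T)%N) ->
  (`|\det B| <= (2 * T).+1 ^ r)%N.
Proof.
move=> /boolp.choice[f fP].
have [L Lu [R Ru [d _ defB]]] := int_Smith_normal_form B.
pose D (i : 'I_r) : nat := absz (nth 0 d i).
have detB : `|\det B|%N = (\prod_(i < r) D i)%N.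
  rewrite defB !det_mulmx !abszM absz_unitmx_det // (absz_unitmx_det Ru).
  rewrite mul1n muln1.
  have -> : \matrix_(i, j) (d`_i *+ (i == j :> nat)) =
            diag_mx (\row_(i < r) d`_i) :> 'M[int]_r.
    by apply/matrixP => i j; rewrite !mxE.
  rewrite det_diag (big_morph absz abszM (erefl _)) /=.
  by apply: eq_bigr => i _; rewrite mxE.
rewrite detB -card_dffun_ord.
pose v (e : {dffun forall i : 'I_r, 'I_(D i)}) : 'rV[int]_r :=
  (\row_i (e i)%:Z) *m R.
(* Reducing [v e] modulo the rows of [B] leaves entries in [-T, T]; the shift by [T] moves them to
   [0, 2T], within the range of [inord]. *)
pose phi e : {ffun 'I_r -> 'I_(2 * T).+1} :=
  [ffun k => inord `|((v e - f (v e) *m B) 0 k + T%:Z)%R|%N].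
suff phi_inj : injective phi.
  by have := leq_card _ phi_inj; rewrite card_ffun !card_ord.
move=> e e' /ffunP eqphi.
have eqv : v e - f (v e) *m B = v e' - f (v e') *m B.
  apply/rowP => k; have := eqphi k; rewrite !ffunE => /(congr1 val) /=.
  have := fP (v e) k; have := fP (v e') k.
  set x := (v e' - _) 0 k; set y := (v e - _) 0 k => hx hy.
  by rewrite !inordK; lia.
have {}eqv : (v e - v e') *m invmx R =
    (f (v e) - f (v e')) *m L *m \matrix_(i, j) (d`_i *+ (i == j :> nat)).
  have -> : v e - v e' = (f (v e) - f (v e')) *m B.
    rewrite mulmxBl; move/eqP: eqv; rewrite subr_eq => /eqP e1; rewrite [X in X - _ = _]e1.
    by rewrite addrAC [_ - _ - _]addrAC subrr sub0r addrC.
  by rewrite defB !mulmxA mulmxK.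
apply/ffunP => i; apply/val_inj => /=.
have := congr1 (fun w : 'rV[int]_r => w 0 i) eqv.
rewrite /v -mulmxBl mulmxK // !mxE (bigD1 i) //= big1 => [|j ji]; last first.
  by rewrite mxE (inj_eq val_inj) (negPf ji) mulr0n mulr0.
rewrite mxE eqxx mulr1n addr0.
move: (_ *m _) => w; move: (w 0 i) => c.
have := ltn_ord (e i); have := ltn_ord (e' i).
move: (nat_of_ord (e i)) (nat_of_ord (e' i)) => a b; rewrite /D.
move: (d`_i) => D' lb la E.
(* By [E] the difference of [a] and [b] is a multiple of [D']; as both are less than the absolute
   value of [D'], the multiplier [c] must vanish. *)
have [c0|c0] := eqVneq c 0; first by move: E; rewrite c0; lia.
have : (`|a%:Z - b%:Z| = `|c| * `|D'|)%N by rewrite E abszM.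
have : (0 < `|c|)%N by rewrite absz_gt0.
nia.
Qed.

Lemma mulmx_row_bound (R : realType) (m n : nat) (v : 'rV[R]_m)
    (A : 'M[R]_(m, n)) (c a : R) (k : 'I_n) :
  (forall j, `|v 0 j| <= c) -> (forall j, `|A j k| <= a) ->
  `|(v *m A) 0 k| <= m%:R * (c * a).
Proof.
move=> vc Aa; rewrite mxE; apply: le_trans (ler_norm_sum _ _ _) _.
have -> : m%:R * (c * a) = \sum_(j < m) (c * a).
  by rewrite sumr_const card_ord mulr_natl.
by apply: ler_sum => j _; rewrite normrM ler_pM.
Qed.

Lemma cvg_det (R : realType) (n : nat) (A_ : nat -> 'M[R]_n) (A : 'M[R]_n) :
  (forall i j, (fun m => A_ m i j) @ \oo --> A i j)%classic ->
  ((fun m => \det (A_ m)) @ \oo --> \det A)%classic.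
Proof.
move=> cA; apply: cvg_big => [|s _]; first exact: add_continuous.
apply: cvgM; first exact: cvg_cst.
apply: cvg_big => [|i _]; [exact: mul_continuous | exact: cA].
Qed.

Lemma mx_entry_bound (R : realType) (m n : nat) (A : 'M[R]_(m, n)) :
  exists2 a, 0 <= a & forall i j, `|A i j| <= a.
Proof.
exists (\sum_i \sum_j `|A i j|) => [|i j].
  by apply: sumr_ge0 => i _; apply: sumr_ge0.
rewrite (bigD1 i) //= (bigD1 j) //= -addrA lerDl addr_ge0 ?sumr_ge0 // => k _.
exact: sumr_ge0.
Qed.

(* Approximating [N *: A] by the integer matrix [B], a covering of the space by
   translates of a box along the rows of [A] gives boxes of integer vectors
   meeting all classes modulo [B]. *)
Lemma covering_det_floor (R : realType) (r : nat) (A : 'M[R]_r) (p : R) :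
  0 <= p -> \det A != 0 ->
  (forall y : 'rV[R]_r, exists n : 'rV[int]_r,
     forall k, `|(y - map_mx intr n *m A) 0 k| <= p) ->
  exists2 c : R, 0 <= c & forall N : nat, (0 < N)%N ->
    `|\det (\matrix_(i, j) (Num.floor (N%:R * A i j))%:~R : 'M[R]_r)| <=
      (2 * (N%:R * p + c) + 1) ^+ r.
Proof.
move=> p0 detA cov.
have [a a0 aP] := mx_entry_bound A.
have [b b0 bP] := mx_entry_bound (invmx A).
(* [S] bounds the entries of the reduced point [y] below, [r * ((S + p) * b)] those of the integer
   vector covering it, and [c] the error of replacing [N *: A] by [B]. None of them depends on
   [N]. *)
pose S := r%:R * (1 * (a + 1)).
pose c := r%:R * (r%:R * ((S + p) * b) * 1).
have S0 : 0 <= S by rewrite mulr_ge0 ?ler0n // mulr_ge0 ?addr_ge0.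
have c0 : 0 <= c.
  by rewrite /c mulr_ge0 // mulr_ge0 // !mulr_ge0 // addr_ge0.
exists c => // N N0; have NR : 0 < N%:R :> R by rewrite ltr0n.
pose B : 'M[int]_r := \matrix_(i, j) Num.floor (N%:R * A i j).
have BE : map_mx intr B = \matrix_(i, j) (Num.floor (N%:R * A i j))%:~R :> 'M[R]_r.
  by apply/matrixP => i j; rewrite !mxE.
have BA i j : `|(N%:R *: A - map_mx intr B) i j| <= 1.
  rewrite !mxE; have /andP[h1 h2] := floor_itv (N%:R * A i j).
  by rewrite intrD in h2; rewrite ler_norml; apply/andP; split; lra.
rewrite -BE; have [->|detB] := eqVneq (\det (map_mx intr B : 'M[R]_r)) 0.
  by rewrite normr0 exprn_ge0 // addr_ge0 // mulr_ge0 // addr_ge0 // mulr_ge0.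
have Bu : (map_mx intr B : 'M[R]_r) \in unitmx by rewrite unitmxE unitfE.
have Au : A \in unitmx by rewrite unitmxE unitfE.
have T0 : 0 <= N%:R * p + c by rewrite addr_ge0 // mulr_ge0 // ltW.
have -> : \det (map_mx intr B : 'M[R]_r) = (\det B)%:~R by rewrite det_map_mx.
rewrite -intr_norm -[`|\det B|]abszE.
apply: (@le_trans _ _ ((2 * Num.truncn (N%:R * p + c)).+1%:R ^+ r)); last first.
  apply: lerXn2r; rewrite ?nnegrE ?ler0n ?addr_ge0 ?mulr_ge0 //.
  rewrite -natr1 natrM lerD2r ler_pM2l //.
  by rewrite truncn_le.
rewrite -natrX ler_nat; apply: det_le_box => w.
(* [t] holds the coordinates of [w] along the rows of [B]. Its fractional part, mapped back and
   scaled down by [N], is a point [y] of bounded size to which the covering hypothesis applies. *)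
pose t := (map_mx intr w : 'rV[R]_r) *m invmx (map_mx intr B).
pose n0 : 'rV[int]_r := map_mx Num.floor t.
pose y := N%:R^-1 *: ((t - map_mx intr n0) *m map_mx intr B).
have [n nP] := cov y; exists (n0 + n) => k.
have yP j : `|y 0 j| <= S.
  rewrite /y scalemxAr; apply: mulmx_row_bound => i.
    rewrite /n0; move: (t) => t'; rewrite !mxE.
    have /andP[h1 h2] := floor_itv (t' 0 i); rewrite intrD in h2.
    by rewrite ler_norml; apply/andP; split; lra.
  have := BA i j; have := aP i j; rewrite !mxE.
  move: (Num.floor _) => z h1 h2.
  rewrite normrM normfV (gtr0_norm NR) mulrC ler_pdivrMr //.
  have -> : z%:~R = N%:R * A i j - (N%:R * A i j - z%:~R) by rewrite opprB addrC subrK.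
  apply: le_trans (ler_normB _ _) _; rewrite normrM (gtr0_norm NR) mulrC.
  have : 1 <= N%:R :> R by rewrite ler1n.
  nra.
have nb j : `|(map_mx intr n : 'rV[R]_r) 0 j| <= r%:R * ((S + p) * b).
  have -> : map_mx intr n = (y - (y - map_mx intr n *m A)) *m invmx A.
    by rewrite subKr mulmxK.
  apply: mulmx_row_bound => // i.
  by rewrite mxE [X in _ + X]mxE; apply: le_trans (ler_normB _ _) _; apply: lerD.
have key : map_mx intr (w - (n0 + n) *m B) =
    N%:R *: (y - map_mx intr n *m A) +
    map_mx intr n *m (N%:R *: A - map_mx intr B) :> 'rV[R]_r.
  rewrite scalerBr /y scalerA divff ?gt_eqF // scale1r map_mxB map_mxM map_mxD.
  rewrite mulmxBr -scalemxAr mulmxDl mulmxBl /t mulmxKV //.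
  by rewrite opprD !addrA addrNK.
rewrite truncn_ge_nat // -[(absz _)%:R]/((absz _)%:Z%:~R) abszE intr_norm.
have -> : ((w - (n0 + n) *m B) 0 k)%:~R = (map_mx intr (w - (n0 + n) *m B) : 'rV[R]_r) 0 k.
  by rewrite [RHS]mxE.
rewrite key mxE; apply: le_trans (ler_normD _ _) _; apply: lerD.
  by rewrite mxE normrM gtr0_norm // ler_pM2l.
by rewrite /c; apply: mulmx_row_bound.
Qed.

(** The previous bound for N = m + 1 is divided by N ^ r. As m grows, the rounded matrices [A_ m]
    tend to [A], the determinant is continuous, and the right-hand side tends to (2p) ^ r. *)
Lemma covering_det_le (R : realType) (r : nat) (A : 'M[R]_r) (p : R) :
  0 <= p ->
  (forall y : 'rV[R]_r, exists n : 'rV[int]_r,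
     forall k, `|(y - map_mx intr n *m A) 0 k| <= p) ->
  `|\det A| <= (2 * p) ^+ r.
Proof.
move=> p0 cov; have [->|detA] := eqVneq (\det A) 0.
  by rewrite normr0 exprn_ge0 // mulr_ge0.
have [c c0 cP] := covering_det_floor p0 detA cov.
pose A_ (m : nat) : 'M[R]_r :=
  \matrix_(i, j) ((Num.floor (m.+1%:R * A i j))%:~R / m.+1%:R).
have cvgA i j : ((fun m => A_ m i j) @ \oo --> A i j)%classic.
  apply/cvgrPdist_le => e e0; near=> m; rewrite mxE.
  have m0 : 0 < m.+1%:R :> R by rewrite ltr0n.
  have /andP[h1 h2] := floor_itv (m.+1%:R * A i j); rewrite intrD in h2.
  have -> : A i j - (Num.floor (m.+1%:R * A i j))%:~R / m.+1%:R =
    (m.+1%:R * A i j - (Num.floor (m.+1%:R * A i j))%:~R) / m.+1%:R.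
    by rewrite mulrBl mulrAC divff ?mul1r // pnatr_eq0.
  rewrite normrM normfV (gtr0_norm m0) ler_pdivrMr //.
  apply: (@le_trans _ _ 1).
    by rewrite ler_norml; apply/andP; split; lra.
  rewrite -ler_pdivrMl // mulr1.
  apply: (@le_trans _ _ m%:R); last by rewrite ler_nat.
  by near: m; exact: nbhs_infty_ger.
have cvgU : ((fun m : nat => (2 * p + (2 * c + 1) / m.+1%:R) ^+ r) @ \oo -->
             (2 * p + (2 * c + 1) * 0) ^+ r)%classic.
  apply: (@cvg_comp _ _ _ _ (fun x : R => x ^+ r)); last exact: exprn_continuous.
  by apply: cvgD; [exact: cvg_cst | apply: cvgM; [exact: cvg_cst | exact: cvg_harmonic]].
rewrite mulr0 addr0 in cvgU.
have cvgN : ((fun m => `|\det (A_ m)|) @ \oo --> `|\det A|)%classic.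
  exact: cvg_norm (cvg_det cvgA).
rewrite -(cvg_lim _ cvgU) // -(cvg_lim _ cvgN) //.
apply: ler_lim; [exact: cvgP cvgN | exact: cvgP cvgU |].
near=> m.
have m0 : 0 < m.+1%:R :> R by rewrite ltr0n.
have -> : A_ m = m.+1%:R^-1 *: \matrix_(i, j) (Num.floor (m.+1%:R * A i j))%:~R.
  by apply/matrixP => i j; rewrite !mxE mulrC.
rewrite detZ normrM normrX normfV (gtr0_norm m0) exprVn mulrC ler_pdivrMr ?exprn_gt0 //.
apply: le_trans (cP m.+1 isT) _; rewrite -exprMn.
suff -> : (2 * p + (2 * c + 1) / m.+1%:R) * m.+1%:R = 2 * (m.+1%:R * p + c) + 1.
  by [].
by rewrite mulrDl divfK ?pnatr_eq0 //; ring.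
Unshelve. all: by end_near.
Qed.

(* Pigeonhole: [(N + 1) ^ d] integer vectors with entries in [0, N] fall into at
   most [N ^ d] boxes. *)
Lemma linear_forms_small (R : realType) (d : nat) (G : 'M[R]_d) :
  (0 < d)%N ->
  exists2 C : R, 1 <= C & forall delta : 'I_d -> R,
    (forall k, 0 < delta k) -> \prod_k delta k = 1 ->
    exists2 a : 'rV[int]_d, a != 0 &
      forall k, `|(map_mx intr a *m G) 0 k| <= C * delta k.
Proof.
move=> d0; have [g g0 gP] := mx_entry_bound G.
pose B := 1 + d%:R * g; have B1 : 1 <= B by rewrite lerDl mulr_ge0.
exists (3 * B) => [|delta delta0 delta1]; first lra.
pose N := (Num.truncn (1 + \sum_k 3 * delta k)).+1.
have Ndelta k : 3 * delta k <= N%:R.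
  apply: le_trans (ltW (truncnS_gt _)).
  rewrite (bigD1 k) //= addrCA lerDl addr_ge0 // sumr_ge0 // => i _.
  by rewrite mulr_ge0 // ltW.
pose v (a : {ffun 'I_d -> 'I_N.+1}) : 'rV[R]_d := (\row_j (a j)%:R) *m G.
have vP a k : `|v a 0 k| <= N%:R * B.
  rewrite (@le_trans _ _ (d%:R * (N%:R * g))) //.
    apply: mulmx_row_bound => // j; rewrite mxE normr_nat ler_nat.
    by rewrite -ltnS.
  by rewrite mulrCA ler_wpM2l // lerDr.
(* [h k x] is the index of the interval of length [3 * B * delta k] containing [x], counted from -N
   B. There are at most (2/3) N / delta k + 1 of them, which is at most N / delta k since N >= 3
   delta k; the product over [k] is then at most N ^ d. *)
pose h k (x : R) := Num.truncn ((x + N%:R * B) / (3 * B * delta k)).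
pose n k := (h k (N%:R * B)).+1.
have den k : 0 < 3 * B * delta k by rewrite !mulr_gt0 //; lra.
have hn a k : (h k (v a 0%R k) < n k)%N.
  rewrite ltnS; apply: le_truncn; rewrite ler_pM2r ?invr_gt0 // lerD2r.
  by have := vP a k; rewrite ler_norml => /andP[].
pose phi a : {dffun forall k : 'I_d, 'I_(n k)} :=
  finfun (fun k => Ordinal (hn a k)).
have nle k : (n k)%:R <= N%:R / delta k.
  rewrite /n -natr1; have dk := delta0 k.
  apply: (@le_trans _ _ ((N%:R * B + N%:R * B) / (3 * B * delta k) + 1)).
    rewrite lerD2r truncn_le divr_ge0 ?(ltW (den k)) //.
    by rewrite addr_ge0 // mulr_ge0 //; lra.
  have -> : (N%:R * B + N%:R * B) / (3 * B * delta k) =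
            (2 / 3) * (N%:R / delta k).
    by field; rewrite gt_eqF //=; lra.
  have : 3 <= N%:R / delta k by rewrite ler_pdivlMr.
  lra.
have [phi_inj|] := boolP (injectiveb phi).
  have := leq_card _ (injectiveP _ phi_inj).
  rewrite card_ffun card_dffun_ord !card_ord -(ler_nat R) natr_prod => le1.
  have : (N.+1 ^ d)%:R <= \prod_(k < d) (N%:R / delta k).
    by apply: le_trans le1 _; apply: ler_prod => k _; rewrite ler0n nle.
  rewrite big_split /= prodfV delta1 invr1 mulr1 prodr_const card_ord -natrX.
  by rewrite ler_nat leqNgt ltn_exp2r // ltnSn.
move=> /injectivePn[a [a' neq_a eq_phi]].
exists (\row_j ((a j)%:Z - (a' j)%:Z)) => [|k].
  apply: contraNneq neq_a => /rowP a0; apply/eqP/ffunP => j; apply/val_inj => /=.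
  by have := a0 j; rewrite !mxE => /eqP; rewrite subr_eq0 => /eqP[].
have -> : map_mx intr (\row_j ((a j)%:Z - (a' j)%:Z)) *m G = v a - v a'.
  by rewrite /v -mulmxBl; congr (_ *m _); apply/rowP => j; rewrite !mxE intrB.
have : h k (v a 0 k) = h k (v a' 0 k).
  by move/ffunP: eq_phi => /(_ k); rewrite !ffunE => /(congr1 val).
rewrite [X in `|X|]mxE [X in _ + X]mxE /h.
have := vP a k; have := vP a' k; rewrite !ler_norml.
move: (v a 0 k) (v a' 0 k) => x y /andP[hy _] /andP[hx _] exy.
have x0 : 0 <= (x + N%:R * B) / (3 * B * delta k) by rewrite divr_ge0 ?(ltW (den k)) //; lra.
have y0 : 0 <= (y + N%:R * B) / (3 * B * delta k) by rewrite divr_ge0 ?(ltW (den k)) //; lra.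
have := truncn_itv x0; have := truncn_itv y0; rewrite exy.
move: (Num.truncn _) => m; rewrite !ler_pdivlMr // !ltr_pdivrMr // -natr1.
move: (den k); move: (3 * B * delta k) => D D0 /andP[h1 h2] /andP[h3 h4].
by apply/andP; split; nra.
Qed.

(** * Real spans and rounding to a subgroup *)

(** Adjoining elements of [A] outside the current span raises the dimension, so this stops. It turns
    [real_span] into the span of one finite family. *)
Lemma span_witness (R : realType) (n : nat) (A : set 'rV[R]_n) :
  exists X : seq 'rV[R]_n,
    (forall w, w \in X -> A w) /\ (forall w, A w -> w \in <<X>>%VS).
Proof.
have grow (m : nat) : exists X : seq 'rV[R]_n, (forall w, w \in X -> A w) /\
    ((m <= \dim <<X>>)%N \/ (forall w, A w -> w \in <<X>>%VS)).
  elim: m => [|m [X [XA [le_m|XP]]]]; first by exists [::]; split => //; left.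
    have [XP|] := pselect (forall w, A w -> w \in <<X>>%VS).
      by exists X; split=> //; right.
    move=> /existsNP[w /not_implyP[Aw /negP wX]].
    exists (w :: X); split.
      by move=> z; rewrite inE => /predU1P[->//|/XA].
    left; rewrite span_cons; apply: leq_ltn_trans le_m _.
    rewrite ltn_neqAle dimvS ?addvSr // andbT.
    apply: contra wX => /eqP eqd.
    have /eqP -> : <<X>>%VS == (<[w]> + <<X>>)%VS by rewrite eqEdim addvSr eqd leqnn.
    by rewrite memvE addvSl.
  by exists X; split => //; right.
have [X [XA [le_dim|XP]]] := grow (\dim {:'rV[R]_n}).+1; last by exists X.
by have := leq_trans le_dim (dimvS (subvf _)); rewrite ltnn.
Qed.

Lemma real_spanP (R : realType) (n : nat) (A : set 'rV[R]_n)
    (X : seq 'rV[R]_n) (v : 'rV[R]_n) :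
  (forall w, w \in X -> A w) -> (forall w, A w -> w \in <<X>>%VS) ->
  real_span A v <-> v \in <<X>>%VS.
Proof.
move=> XA AX; split=> [[Y [YA vY]]|vX]; last by exists X.
by apply: subvP vY; apply/span_subvP => w /YA /AX.
Qed.

(** Taking floors of the coordinates along [X] leaves coefficients in [0, 1). The bound does not
    depend on [v], which makes the covering radius finite. *)
Lemma span_round (R : realType) (n : nat) (A : set 'rV[R]_n)
    (X : seq 'rV[R]_n) (v : 'rV[R]_n) :
  A 0 -> (forall x y, A x -> A y -> A (x + y)) -> (forall x, A x -> A (- x)) ->
  (forall w, w \in X -> A w) -> v \in <<X>>%VS ->
  exists2 w, A w & `|v - w| <= \sum_(x <- X) `|x|.
Proof.
move=> A0 AD AN XA; rewrite -[X]in_tupleE => vX; rewrite (coord_span vX).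
set X' := in_tuple X; pose c i := coord X' i v.
have Az (x : 'rV[R]_n) (z : int) : A x -> A (x *~ z).
  have Am (m : nat) : A x -> A (x *+ m).
    by move=> Ax; elim: m => [|m IH]; rewrite ?mulr0n // mulrS; apply: AD.
  by move=> Ax; case: z => m; [exact: Am | apply: AN; exact: Am].
exists (\sum_(i < size X) X'`_i *~ Num.floor (c i)).
  by apply: big_ind => // i _; apply/Az/XA/mem_nth.
rewrite -sumrB (big_nth 0) big_mkord.
apply: le_trans (ler_norm_sum _ _ _) _; apply: ler_sum => i _.
rewrite -/(c i) -scaler_int -scalerBl normrZ ler_piMl //.
have /andP[h1 h2] := floor_itv (c i); rewrite intrD in h2.
by rewrite ler_norml; apply/andP; split; lra.
Qed.

(** * Embeddings and norms *)

Lemma integral_ratP (q : rat) :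
  integralOver (intr : int -> rat) q -> exists z : int, q = z%:~R.
Proof.
move=> [p p_monic p_root].
have : (ratr q : algC) \in Num.int.
  apply: Cint_rat_Aint; first exact: Crat_rat.
  apply: (@root_monic_Aint (map_poly intr p)).
  - have -> : map_poly intr p = map_poly ratr (map_poly intr p : {poly rat}) :> {poly algC}.
      by rewrite -map_poly_comp; apply: eq_map_poly => z /=; rewrite ratr_int.
    by rewrite fmorph_root.
  - exact: monic_map.
  - by apply/polyOverP => i; rewrite coef_map /= intr_int.
move=> /intrP[z zP]; exists z; apply: (fmorph_inj (ratr : {rmorphism rat -> algC})).
by rewrite /= zP ratr_int.
Qed.

(** With a the leading coefficient and n + 1 the degree of [p], multiplying p(y) = 0 by a ^ n gives
    a monic equation for a y with coefficients p_i a ^ (n - i). If [p] is constant, it has a root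
    only if a vanishes in [F], and then a y = 0. *)
Lemma integral_multiple (F : fieldType) (p : {poly int}) (y : F) :
  p != 0 -> root (map_poly intr p) y ->
  integralOver (intr : int -> F) ((lead_coef p)%:~R * y).
Proof.
move=> p0 /rootP py; set a := lead_coef p; set n := (size p).-1.
have sp : size p = n.+1 by rewrite prednK // lt0n size_poly_eq0.
case: n sp => [|n] sp.
  have /eqP/size_poly1P[c c0 pc] := sp.
  move: py; rewrite pc map_polyC hornerC /= => c00.
  by rewrite /a pc lead_coefC c00 mul0r; apply: mxpoly.integral0.
pose g : {poly int} := 'X^(n.+1) + \poly_(i < n.+1) (p`_i * a ^+ (n - i)).
exists g.
  rewrite monicE lead_coefDl ?lead_coefXn // size_polyXn.
  exact: size_poly.
apply/rootP; rewrite /g rmorphD /= map_polyXn hornerD hornerXn.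
have horn (q : {poly int}) (x : F) m : (size q <= m)%N ->
    (map_poly intr q).[x] = \sum_(i < m) (q`_i)%:~R * x ^+ i.
  move=> qm; rewrite (@horner_coef_wide _ m); last exact: leq_trans (size_poly _ _) qm.
  by apply: eq_bigr => i _; rewrite coef_map.
rewrite (horn _ _ n.+1 (size_poly _ _)).
have := congr1 ( *%R (a%:~R ^+ n)) py; rewrite mulr0 (horn _ _ n.+2) ?sp // => py'; rewrite -[RHS]py'.
have aE : a = p`_n.+1 by rewrite /a lead_coefE sp.
rewrite [in RHS]big_ord_recr /= -aE mulrDr addrC; congr (_ + _).
  rewrite mulr_sumr; apply: eq_bigr => i _; rewrite coef_poly ltn_ord.
  rewrite rmorphM rmorphXn /= exprMn.
  have -> : a%:~R ^+ n = a%:~R ^+ (n - i) * a%:~R ^+ i :> F.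
    by rewrite -exprD subnK // -ltnS.
  by ring.
by rewrite exprMn exprS; ring.
Qed.

(** A separable generator is scaled by an integer to become integral, and [p] is the minimal
    polynomial of the result. The last two conclusions present [K] as Q[X]/(p), from which
    embeddings are built. *)
Lemma primitive_element (K : fieldExtType rat) :
  exists (x : K) (p : {poly rat}),
    [/\ integralOver (intr : int -> K) x, p \is monic, separable_poly p,
        root (map_poly (in_alg K) p) x &
        (forall q, root (map_poly (in_alg K) q) x -> p %| q) /\
        (forall y : K, exists2 q : {poly rat}, (size q < size p)%N &
           y = (map_poly (in_alg K) q).[x])].
Proof.
have char0 : has_char0 K by move=> k; rewrite pchar_lalg pchar_num.
have sepK : separable 1%AS {:K}%AS by apply/separableP => y _; exact: pcharf0_separable.
pose x0 := separable_generator 1%AS {:K}%AS.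
have genx0 : {:K}%VS = <<1; x0>>%VS.
  by rewrite -[LHS]/(asval {:K}%AS) (eq_adjoin_separable_generator sepK (subvf _)).
have /polyOver1P[q0 q0E] := minPolyOver 1%AS x0.
have q0n0 : q0 != 0.
  by rewrite -(map_poly_eq0 (in_alg K)) -q0E monic_neq0 ?monic_minPoly.
have [qz [a a0 q0qz]] := rat_poly_scale q0.
have qzn0 : qz != 0.
  by apply: contraNneq q0n0 => qz0; rewrite q0qz qz0 rmorph0 scaler0.
have rqz : root (map_poly intr qz) x0.
  have := root_minPoly 1%AS x0.
  rewrite q0E q0qz map_polyZ rootZ ?fmorph_eq0 ?invr_eq0 ?intr_eq0 //.
  rewrite -map_poly_comp; congr (root _ _); apply: eq_map_poly => z.
  exact: (rmorph_int (in_alg K)).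
pose x := (lead_coef qz)%:~R * x0.
have genx : {:K}%VS = <<1; x>>%VS.
  apply/eqP; rewrite eqEsubv subvf andbT [X in (X <= _)%VS]genx0.
  apply/FadjoinP; split; first exact: subv_adjoin.
  have -> : x0 = (lead_coef qz)%:~R^-1 * x.
    rewrite /x mulKf // -[_%:~R](rmorph_int (in_alg K)) fmorph_eq0.
    by rewrite intr_eq0 lead_coef_eq0.
  apply: rpredM; last exact: memv_adjoin.
  by rewrite rpredV; apply: rpred_int.
have /polyOver1P[p pE] := minPolyOver 1%AS x.
exists x, p; split.
- exact: integral_multiple.
- by rewrite -(map_monic (in_alg K)) -pE monic_minPoly.
- by rewrite -(separable_map (in_alg K)) -pE; apply: pcharf0_separable.
- by rewrite -pE root_minPoly.
split=> [q qx|y].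
  rewrite -(dvdp_map (in_alg K)) -pE; apply: minPoly_dvdp => //.
  by apply/polyOver1P; exists q.
have /Fadjoin_poly_eq yE : y \in <<1%AS; x>>%VS by rewrite -genx memvf.
have /polyOver1P[q qE] := Fadjoin_polyOver 1%AS x y.
exists q; last by rewrite -qE yE.
rewrite -(size_map_poly (in_alg K) q) -(size_map_poly (in_alg K) p) -pE -qE.
by rewrite size_minPoly ltnS size_Fadjoin_poly.
Qed.

Lemma rmorph_horner_alg (K : fieldExtType rat) (C : unitRingType)
    (tau : {rmorphism K -> C}) (q : {poly rat}) (x : K) :
  tau (map_poly (in_alg K) q).[x] = (map_poly ratr q).[tau x].
Proof.
rewrite -horner_map -map_poly_comp; congr horner.
by apply: eq_map_poly => a /=; rewrite rmorphZ_num rmorph1 mulr1.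
Qed.

(** Evaluation at [z] factors through Q[X]/(p): two polynomials representing the same element of [K]
    differ by a multiple of [p], which vanishes at [z]. Hence the chosen representatives [Q] do not
    matter. *)
Lemma embedding_of_root (K : fieldExtType rat) (C : numFieldType) (x : K)
    (p : {poly rat}) (z : C) :
  (forall q, root (map_poly (in_alg K) q) x -> p %| q) ->
  (forall y : K, exists2 q : {poly rat}, (size q < size p)%N &
     y = (map_poly (in_alg K) q).[x]) ->
  root (map_poly ratr p) z -> exists tau : {rmorphism K -> C}, tau x = z.
Proof.
move=> pmin pgen pz.
have /boolp.choice[Q QP] : forall y, exists q, y = (map_poly (in_alg K) q).[x].
  by move=> y; have [q _ qP] := pgen y; exists q.
pose tau y := (map_poly (ratr : rat -> C) (Q y)).[z].
have tauP q : tau (map_poly (in_alg K) q).[x] = (map_poly ratr q).[z].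
  apply/eqP; rewrite /tau -subr_eq0 -hornerN -hornerD -rmorphB.
  have : p %| (Q (map_poly (in_alg K) q).[x] - q).
    by apply: pmin; rewrite rmorphB /root hornerD hornerN -QP subrr.
  move=> /dvdpP[u ->]; rewrite rmorphM hornerM (rootP pz) mulr0.
  by [].
have tauB : zmod_morphism tau.
  move=> u v; rewrite {1}(QP u) {1}(QP v) -hornerN -hornerD -rmorphB tauP.
  by rewrite rmorphB hornerD hornerN.
have tauM : monoid_morphism tau.
  split=> [|u v].
    have <- : (map_poly (in_alg K) 1).[x] = 1 by rewrite rmorph1 hornerC.
    by rewrite tauP rmorph1 hornerC.
  by rewrite {1}(QP u) {1}(QP v) -hornerM -rmorphM tauP rmorphM hornerM.
exists (HB.pack_for {rmorphism K -> C} tau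
  (GRing.isZmodMorphism.Build _ _ tau tauB)
  (GRing.isMonoidMorphism.Build _ _ tau tauM)).
have {1}-> : x = (map_poly (in_alg K) 'X).[x] by rewrite map_polyX hornerX.
by rewrite /= tauP map_polyX hornerX.
Qed.

(** Here [tau] lists every complex embedding exactly once, so [d] is the degree of [K]. Injectivity
    is required at [x] itself because it makes the Vandermonde matrix of the conjugates of [x]
    invertible. *)
Definition power_basis (R : realType) (K : fieldExtType rat) (d : nat)
    (tau : 'I_d -> {rmorphism K -> R[i]}) (x : K) : Prop :=
  [/\ integralOver (intr : int -> K) x, (0 < d)%N,
      injective (fun k => tau k x),
      forall sigma : {rmorphism K -> R[i]}, exists k, sigma =1 tau k
    & forall y, exists a : 'rV[rat]_d, y = \sum_j a 0 j *: x ^+ j].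

Lemma power_basis_exists (R : realType) (K : fieldExtType rat) :
  exists (d : nat) (tau : 'I_d -> {rmorphism K -> R[i]}) (x : K),
    power_basis tau x.
Proof.
have [x [p [x_int p_monic p_sep px [pmin pgen]]]] := primitive_element K.
have [rs rsE] := closed_field_poly_normal (map_poly (ratr : rat -> R[i]) p).
have /monicP lc : map_poly (ratr : rat -> R[i]) p \is monic by rewrite map_monic.
rewrite lc scale1r in rsE.
have rs_uniq : uniq rs by rewrite -separable_prod_XsubC -rsE separable_map.
have p0 : p != 0 by rewrite monic_neq0.
have size_p : size p = (size rs).+1.
  by rewrite -(size_map_poly (ratr : {rmorphism rat -> R[i]})) rsE size_prod_XsubC.
have rsP z : (z \in rs) = root (map_poly ratr p) z.
  by rewrite rsE root_prod_XsubC.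
have /boolp.choice[tau tauP] : forall k : 'I_(size rs),
    exists t : {rmorphism K -> R[i]}, t x = rs`_k.
  by move=> k; apply: (embedding_of_root pmin pgen); rewrite -rsP mem_nth.
have tau_eq (s t : {rmorphism K -> R[i]}) : s x = t x -> s =1 t.
  by move=> st y; have [q _ ->] := pgen y; rewrite !rmorph_horner_alg st.
exists (size rs), tau, x; split => //.
- rewrite lt0n; apply: contraTneq px => rs0; rewrite rs0 in size_p.
  have /eqP/size_poly1P[c c0 ->] := size_p.
  by rewrite map_polyC rootC fmorph_eq0.
- move=> k l; rewrite !tauP => /eqP.
  by rewrite nth_uniq // => /eqP/val_inj.
- move=> s; have : s x \in rs.
    rewrite rsP /root -rmorph_horner_alg (rootP px) rmorph0.
    by [].
  move=> sx; have ks : (index (s x) rs < size rs)%N by rewrite index_mem.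
  by exists (Ordinal ks); apply: tau_eq; rewrite tauP nth_index.
- move=> y; have [q q_size yE] := pgen y.
  exists (\row_j q`_j); rewrite {1}yE (@horner_coef_wide _ (size rs)).
    by apply: eq_bigr => j _; rewrite mxE coef_map /= -scalerAl mul1r.
  by rewrite size_map_poly -ltnS -size_p.
Qed.

Local Notation normc := ComplexField.Normc.normc.

Lemma integral_fmorph (F E : fieldType) (tau : {rmorphism F -> E}) (y : F) :
  integralOver (intr : int -> E) (tau y) <-> integralOver (intr : int -> F) y.
Proof.
have mapE (p : {poly int}) : map_poly intr p = map_poly tau (map_poly intr p) :> {poly E}.
  by rewrite -map_poly_comp; apply: eq_map_poly => z /=; rewrite rmorph_int.
by split=> -[p p_monic py]; exists p => //; move: py; rewrite mapE fmorph_root.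
Qed.

Lemma integral_prod (F : fieldType) (I : Type) (s : seq I) (P : pred I) (f : I -> F) :
  (forall i, P i -> integralOver (intr : int -> F) (f i)) ->
  integralOver (intr : int -> F) (\prod_(i <- s | P i) f i).
Proof.
by move=> fP; apply: big_ind => //; [exact: integral1 | exact: integral_mul].
Qed.

Lemma integral_exp (F : fieldType) (y : F) (n : nat) :
  integralOver (intr : int -> F) y -> integralOver (intr : int -> F) (y ^+ n).
Proof.
move=> y_int; elim: n => [|n IH]; first exact: integral1.
by rewrite exprS; exact: integral_mul.
Qed.

Lemma integral_sum (F : fieldType) (I : Type) (s : seq I) (P : pred I) (f : I -> F) :
  (forall i, P i -> integralOver (intr : int -> F) (f i)) ->
  integralOver (intr : int -> F) (\sum_(i <- s | P i) f i).
Proof.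
by move=> fP; apply: big_ind => //; [exact: mxpoly.integral0 | exact: integral_add].
Qed.

Lemma normc_real (R : realType) (a : R) : normc a%:C = `|a|.
Proof. by rewrite /= expr0n addr0 sqrtr_sqr. Qed.

Lemma normc_prod (R : realType) (I : Type) (s : seq I) (P : pred I) (f : I -> R[i]) :
  normc (\prod_(i <- s | P i) f i) = \prod_(i <- s | P i) normc (f i).
Proof.
by apply: big_morph; [exact: ComplexField.Normc.normcM | exact: ComplexField.Normc.normc1].
Qed.

Lemma det_Vandermonde_neq0 (R : realType) (K : fieldExtType rat) (d : nat)
    (tau : 'I_d -> {rmorphism K -> R[i]}) (x : K) :
  injective (fun k => tau k x) -> \det (Vandermonde d (\row_k tau k x)) != 0.
Proof.
move=> tau_inj; rewrite det_Vandermonde.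
apply/prodf_neq0 => i _; apply/prodf_neq0 => j ij.
rewrite !mxE subr_eq0; apply: contraTneq ij => /tau_inj ->.
by rewrite ltnn.
Qed.

(* The product of the embeddings of [y] is the determinant of the rational
   matrix of multiplication by [y]: the Vandermonde matrix diagonalizes it. *)
Lemma prod_embeddings_rat (R : realType) (K : fieldExtType rat) (d : nat)
    (tau : 'I_d -> {rmorphism K -> R[i]}) (x y : K) :
  power_basis tau x -> exists q : rat, \prod_k tau k y = ratr q.
Proof.
move=> [_ _ tau_inj _ basis].
have /boolp.choice[f fP] : forall i : 'I_d, exists a : 'rV[rat]_d,
    y * x ^+ i = \sum_j a 0 j *: x ^+ j by [].
pose M : 'M[rat]_d := \matrix_i f i.
pose V : 'M[R[i]]_d := Vandermonde d (\row_k tau k x).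
pose D : 'M[R[i]]_d := diag_mx (\row_k tau k y).
exists (\det M); rewrite -det_map_mx /=.
have MV : map_mx ratr M *m V = V *m D.
  apply/matrixP => i k; rewrite mul_mx_diag !mxE -rmorphXn -rmorphM mulrC fP.
  rewrite rmorph_sum /=; apply: eq_bigr => j _.
  by rewrite !mxE rmorphZ_num rmorphXn.
have detV : \det V != 0 by exact: det_Vandermonde_neq0.
apply: (mulIf detV); rewrite -det_mulmx MV det_mulmx mulrC det_diag.
by congr (_ * _); apply: eq_bigr => k _; rewrite mxE.
Qed.

Lemma prod_embeddings_int (R : realType) (K : fieldExtType rat) (d : nat)
    (tau : 'I_d -> {rmorphism K -> R[i]}) (x y : K) :
  power_basis tau x -> integralOver (intr : int -> K) y ->
  exists z : int, \prod_k tau k y = z%:~R.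
Proof.
move=> basis y_int; have [q qE] := prod_embeddings_rat y basis.
have : integralOver (intr : int -> R[i]) (ratr q).
  by rewrite -qE; apply: integral_prod => k _; apply/integral_fmorph.
move/(integral_fmorph (ratr : {rmorphism rat -> R[i]}))/integral_ratP => [z zE].
by exists z; rewrite qE zE ratr_int.
Qed.

(** [m] is the absolute value of the norm of [y]. Up to sign, one embedding sends m / y to the
    product of the other conjugates of [y], which is integral, and integrality is reflected by
    embeddings. *)
Lemma norm_embeddings_nat (R : realType) (K : fieldExtType rat) (d : nat)
    (tau : 'I_d -> {rmorphism K -> R[i]}) (x y : K) :
  power_basis tau x -> integralOver (intr : int -> K) y -> y != 0 ->
  exists m : nat, [/\ (0 < m)%N, \prod_k normc (tau k y) = m%:R &
    integralOver (intr : int -> K) (m%:R / y)].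
Proof.
move=> basis y_int y0; have [z zE] := prod_embeddings_int basis y_int.
have z0 : z != 0.
  rewrite -(intr_eq0 R[i]) -zE; apply/prodf_neq0 => k _.
  by rewrite fmorph_eq0.
exists `|z|%N; split; first by rewrite absz_gt0.
  rewrite -normc_prod zE -(rmorph_int (real_complex R)) normc_real.
  by rewrite -intr_norm -abszE.
suff : integralOver (intr : int -> K) (z%:~R / y).
  have [->//|->] : (`|z|%:R = z%:~R :> K) \/ (`|z|%:R = - z%:~R :> K).
    case: z {zE z0} => n; first by left.
    by right; rewrite NegzE rmorphN opprK.
  by rewrite mulNr => /integral_opp.
have [_ d0 _ _ _] := basis; pose k0 := Ordinal d0.
apply/(integral_fmorph (tau k0)); rewrite fmorph_div rmorph_int -zE.
rewrite (bigD1 k0) //= mulrAC divff ?mul1r ?fmorph_eq0 //.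
by apply: integral_prod => k _; apply/integral_fmorph.
Qed.

(** The quotient is 1 + (m / b) c and its inverse is 1 - (m / a) c. *)
Lemma integer_unit_quotient (K : fieldExtType rat) (m : nat) (a b c : K) :
  a != 0 -> b != 0 -> integralOver (intr : int -> K) (m%:R / a) ->
  integralOver (intr : int -> K) (m%:R / b) ->
  integralOver (intr : int -> K) c -> a - b = m%:R * c ->
  integer_unit (a / b).
Proof.
move=> a0 b0 ma mb c_int abE; split.
- by rewrite mulf_neq0 ?invr_eq0.
- have -> : a / b = 1 + m%:R / b * c by rewrite mulrAC -abE mulrBl divff // addrC subrK.
  by apply: integral_add; [exact: integral1 | exact: integral_mul].
- have -> : (a / b)^-1 = 1 - m%:R / a * c.
    by rewrite invf_div mulrAC -abE mulrBl divff // opprB addrC subrK.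
  by apply: integral_sub; [exact: integral1 | exact: integral_mul].
Qed.

(** * Conjugation, places and the logarithmic embedding *)

Lemma conjc_Creal (R : realType) (z : R[i]) : (z \is Num.real) = (z^* == z).
Proof.
case: z => a b; rewrite realE !lecE /= eq_complex /= eqxx /=.
rewrite [0 == b]eq_sym andbC [_ && (a <= 0)]andbC -andb_orl.
by rewrite le_total /= [RHS]eq_sym -[RHS]subr_eq0 opprK -mulr2n mulrn_eq0.
Qed.

Lemma normc_conjc (R : realType) (z : R[i]) : normc z^* = normc z.
Proof. by case: z => a b; rewrite /= sqrrN. Qed.

(** The local degree: the number of embeddings belonging to the place [i], which is also its weight
    in [log_embedding]. *)
Definition place_degree (r1 r2 : nat) (i : 'I_(r1 + r2)) : nat :=
  if (i < r1)%N then 1 else 2.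

Section Places.
Variables (R : realType) (K : fieldExtType rat) (r1 r2 d : nat).
Variables (sigma : 'I_(r1 + r2) -> {rmorphism K -> R[i]}).
Variables (tau : 'I_d -> {rmorphism K -> R[i]}) (x : K).

Lemma place_of_embedding : embedding_system sigma ->
  exists kap : 'I_d -> 'I_(r1 + r2), forall k i,
    kap k = i <-> tau k =1 sigma i \/ (forall y, tau k y = (sigma i y)^*).
Proof.
move=> [_ sigma_inj sigma_all].
have /boolp.choice[kap kapP] := fun k => sigma_all (tau k).
exists kap => k i; split=> [<-//|tki]; apply: sigma_inj.
case: (kapP k) tki => tk [] ti.
- by left => y; rewrite -tk ti.
- by right => y; rewrite -tk ti.
- by right => y; rewrite -ti tk conjcK.
- by left => y; rewrite -[LHS]conjcK -tk ti conjcK.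
Qed.

Lemma conj_embedding : power_basis tau x ->
  forall k, exists l, forall y, tau l y = (tau k y)^*.
Proof.
move=> [_ _ _ tau_all _] k.
have [l lP] := tau_all (conjc \o tau k : {rmorphism K -> R[i]}).
by exists l => y; rewrite -lP.
Qed.

(** The fibre of [kap] over [i] consists of [sigma i] and its conjugate, which coincide exactly when
    [sigma i] is real. *)
Lemma prod_places (kap : 'I_d -> 'I_(r1 + r2)) (F : 'I_(r1 + r2) -> R) :
  embedding_system sigma -> power_basis tau x ->
  (forall k i, kap k = i <->
     tau k =1 sigma i \/ (forall y, tau k y = (sigma i y)^*)) ->
  \prod_k F (kap k) = \prod_i F i ^+ place_degree i.
Proof.
move=> [sigma_real sigma_inj _] [_ _ tau_inj tau_all _] kapP.
rewrite (partition_big kap xpredT) //=; apply: eq_bigr => i _.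
rewrite (eq_bigr (fun=> F i)) => [|k /eqP->//]; rewrite prodr_const; congr (_ ^+ _).
have [a aP] := tau_all (sigma i).
have [b bP] := tau_all (conjc \o sigma i : {rmorphism K -> R[i]}).
rewrite (eq_card (B := [set a; b])) => [|k].
  rewrite cards2 /place_degree.
  suff -> : (a != b) = ~~ (i < r1)%N by case: (i < r1)%N.
  congr (~~ _); apply/eqP/idP => [ab|/sigma_real ir].
    by apply/sigma_real => y; rewrite conjc_Creal; have := bP y; rewrite /= aP ab => ->.
  apply: tau_inj => /=; rewrite -aP -bP /=.
  by have := ir x; rewrite conjc_Creal => /eqP ->.
rewrite !inE; apply/idP/idP => [/eqP/val_inj ki|/orP[]/eqP ->].
- have [tk|tk] := (kapP k i).1 ki; apply/orP; [left|right]; apply/eqP/tau_inj.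
    by rewrite /= -aP tk.
  by rewrite /= -bP tk.
- by apply/eqP/(congr1 val)/kapP; left => y; rewrite aP.
- by apply/eqP/(congr1 val)/kapP; right => y; rewrite -bP.
Qed.

End Places.

Lemma log_embeddingE (R : realType) (K : fieldExtType rat) (r1 r2 : nat)
    (sigma : 'I_(r1 + r2) -> {rmorphism K -> R[i]}) (y : K) (i : 'I_(r1 + r2)) :
  log_embedding sigma y 0 i = (place_degree i)%:R * ln (normc (sigma i y)).
Proof. by rewrite mxE /place_degree; case: ifP; rewrite ?mul1r. Qed.

Lemma normc_gt0 (R : realType) (z : R[i]) : (0 < normc z) = (z != 0).
Proof.
have z0 : 0 <= normc z by case: z => a b; apply: sqrtr_ge0.
rewrite lt0r z0 andbT; congr (~~ _); apply/eqP/eqP => [/ComplexField.Normc.eq0_normc //|->].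
exact: ComplexField.Normc.normc0.
Qed.

Lemma log_embeddingM (R : realType) (K : fieldExtType rat) (r1 r2 : nat)
    (sigma : 'I_(r1 + r2) -> {rmorphism K -> R[i]}) (y z : K) :
  y != 0 -> z != 0 ->
  log_embedding sigma (y * z) = log_embedding sigma y + log_embedding sigma z.
Proof.
move=> y0 z0; apply/rowP => i; rewrite [RHS]mxE !log_embeddingE rmorphM.
rewrite ComplexField.Normc.normcM lnM ?posrE ?normc_gt0 ?fmorph_eq0 //.
by rewrite mulrDr.
Qed.

Lemma log_embedding1 (R : realType) (K : fieldExtType rat) (r1 r2 : nat)
    (sigma : 'I_(r1 + r2) -> {rmorphism K -> R[i]}) :
  log_embedding sigma 1 = 0.
Proof.
apply/rowP => i.
by rewrite log_embeddingE rmorph1 ComplexField.Normc.normc1 ln1 mulr0 mxE.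
Qed.

Lemma log_embeddingV (R : realType) (K : fieldExtType rat) (r1 r2 : nat)
    (sigma : 'I_(r1 + r2) -> {rmorphism K -> R[i]}) (y : K) :
  y != 0 -> log_embedding sigma y^-1 = - log_embedding sigma y.
Proof.
move=> y0; apply/eqP; rewrite -addr_eq0 -log_embeddingM ?invr_eq0 //.
by rewrite mulVf // log_embedding1.
Qed.

(** * Dirichlet's unit theorem *)

(** Under [power_basis] these are the elements of the order Z[x]. Using it in place of the full ring
    of integers avoids an integral basis. *)
Definition int_combination (K : fieldExtType rat) (d : nat) (x : K)
    (a : 'rV[int]_d) : K := \sum_j (a 0 j)%:~R * x ^+ j.

Lemma int_combinationB (K : fieldExtType rat) (d : nat) (x : K)
    (a b : 'rV[int]_d) :
  int_combination x (a - b) = int_combination x a - int_combination x b.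
Proof.
by rewrite -sumrB; apply: eq_bigr => j _; rewrite !mxE intrB mulrBl.
Qed.

Lemma int_combinationZ (K : fieldExtType rat) (d : nat) (x : K)
    (m : int) (a : 'rV[int]_d) :
  int_combination x (m *: a) = m%:~R * int_combination x a.
Proof.
by rewrite mulr_sumr; apply: eq_bigr => j _; rewrite !mxE intrM mulrA.
Qed.

Lemma int_combination_integral (K : fieldExtType rat) (d : nat) (x : K)
    (a : 'rV[int]_d) :
  integralOver (intr : int -> K) x ->
  integralOver (intr : int -> K) (int_combination x a).
Proof.
move=> x_int; apply: integral_sum => j _; apply: integral_mul.
  exact: integral_id.
exact: integral_exp.
Qed.

(** The conjugates of the combination are the entries of [a] times an invertible Vandermonde
    matrix. *)
Lemma int_combination_neq0 (R : realType) (K : fieldExtType rat) (d : nat)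
    (tau : 'I_d -> {rmorphism K -> R[i]}) (x : K) (a : 'rV[int]_d) :
  power_basis tau x -> a != 0 -> int_combination x a != 0.
Proof.
move=> [_ _ tau_inj _ _]; apply: contraNneq => a0.
have detV := det_Vandermonde_neq0 tau_inj.
have : map_mx intr a *m Vandermonde d (\row_k tau k x) = 0 :> 'rV[R[i]]_d.
  apply/rowP => k; rewrite mxE [RHS]mxE; transitivity (tau k (int_combination x a)).
    rewrite rmorph_sum; apply: eq_bigr => j _.
    by rewrite !mxE rmorphM rmorph_int rmorphXn.
  by rewrite a0 rmorph0.
move/(congr1 (mulmx^~ (invmx (Vandermonde d (\row_k tau k x))))).
rewrite mulmxK ?unitmxE ?unitfE // mul0mx => /rowP a00; apply/eqP/rowP => j.
by have := a00 j; rewrite !mxE => /eqP; rewrite intr_eq0 => /eqP.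
Qed.

(** For z = a + i b the hypotheses bound a + b and a - b, and a ^ 2 + b ^ 2 is half the sum of their
    squares. *)
Lemma normc_le_ReIm (R : realType) (z : R[i]) (c : R) :
  `|complex.Re z + complex.Im z| <= c -> `|complex.Re z^* + complex.Im z^*| <= c ->
  normc z <= 2 * c.
Proof.
case: z => a b /= h1 h2.
have c0 : 0 <= c := le_trans (normr_ge0 _) h1.
rewrite -(@ger0_norm _ (2 * c)) ?mulr_ge0 // -sqrtr_sqr ler_sqrt ?sqr_ge0 //.
move: h1 h2; rewrite !ler_norml => /andP[h1 h2] /andP[h3 h4].
nra.
Qed.

(* The real linear forms [Re + Im] of the embeddings: those of a conjugate pair
   are [Re + Im] and [Re - Im], and for a real embedding it is the embedding. *)
Lemma small_element (R : realType) (K : fieldExtType rat) (r1 r2 d : nat)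
    (sigma : 'I_(r1 + r2) -> {rmorphism K -> R[i]})
    (tau : 'I_d -> {rmorphism K -> R[i]}) (x : K) :
  embedding_system sigma -> power_basis tau x ->
  exists2 C : R, 1 <= C & forall v : 'rV[R]_(r1 + r2), \sum_i v 0 i = 0 ->
    exists a : 'rV[int]_d,
      [/\ int_combination x a != 0,
          forall i, normc (sigma i (int_combination x a)) <=
            C * expR (v 0 i / (place_degree i)%:R)
        & \prod_k normc (tau k (int_combination x a)) <= C ^+ d].
Proof.
move=> sys basis; have [x_int d0 tau_inj tau_all _] := basis.
have [kap kapP] := place_of_embedding tau sys.
pose G : 'M[R]_d := \matrix_(j, k)
  (complex.Re (tau k (x ^+ j)) + complex.Im (tau k (x ^+ j))).
have [C C1 CP] := linear_forms_small G d0.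
exists (2 * C) => [|v v0]; first lra.
(* The division by the local degree makes each place contribute exp (v_i) to the product of the
   weights, which is 1 because [v] has sum zero. *)
pose delta k := expR (v 0 (kap k) / (place_degree (kap k))%:R).
have delta0 k : 0 < delta k by exact: expR_gt0.
have pd0 i : (place_degree i)%:R != 0 :> R by rewrite /place_degree; case: ifP; rewrite pnatr_eq0.
have delta1 : \prod_k delta k = 1.
  rewrite (prod_places (fun i => expR (v 0 i / (place_degree i)%:R)) sys basis kapP).
  rewrite -[RHS]expR0 -v0 expR_sum; apply: eq_bigr => i _.
  by rewrite -expRM_natl mulrC divfK.
have [a a0 aP] := CP delta delta0 delta1; exists a.
have GE k : (map_mx intr a *m G) 0 k =
    complex.Re (tau k (int_combination x a)) + complex.Im (tau k (int_combination x a)).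
  rewrite mxE /int_combination rmorph_sum raddf_sum raddf_sum -big_split /=.
  apply: eq_bigr => j _; rewrite !mxE rmorphM rmorph_int.
  rewrite -(rmorph_int (real_complex R)); case: (tau k _) => u w /=.
  by rewrite !mul0r subr0 addr0 mulrDr.
have tau_le k : normc (tau k (int_combination x a)) <= 2 * C * delta k.
  rewrite -mulrA; apply: normc_le_ReIm; first by rewrite -GE; exact: aP.
  have [l lP] := conj_embedding basis k; rewrite -lP -GE.
  (* Conjugate embeddings lie over the same place and so carry the same weight. *)
  suff -> : delta k = delta l by exact: aP.
  rewrite /delta; suff -> : kap k = kap l by [].
  apply/esym/kapP; have [tk|tk] := (kapP k (kap k)).1 erefl.
    by right => y; rewrite lP tk.
  by left => y; rewrite lP tk conjcK.
split; first exact: int_combination_neq0 basis a0.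
  move=> i; have [k kP] := tau_all (sigma i).
  have ki : kap k = i by apply/kapP; left => y; rewrite kP.
  by rewrite kP; have := tau_le k; rewrite /delta ki.
apply: (@le_trans _ _ (\prod_k (2 * C * delta k))).
  by apply: ler_prod => k _; rewrite tau_le andbT; case: (tau k _) => u w; apply: sqrtr_ge0.
by rewrite big_split /= delta1 mulr1 prodr_const card_ord.
Qed.

Lemma sum_log_embedding (R : realType) (K : fieldExtType rat) (r1 r2 d : nat)
    (sigma : 'I_(r1 + r2) -> {rmorphism K -> R[i]})
    (tau : 'I_d -> {rmorphism K -> R[i]}) (x y : K) :
  embedding_system sigma -> power_basis tau x -> y != 0 ->
  \sum_i log_embedding sigma y 0 i = ln (\prod_k normc (tau k y)).
Proof.
move=> sys basis y0; have [kap kapP] := place_of_embedding tau sys.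
have -> : \prod_k normc (tau k y) = \prod_k normc (sigma (kap k) y).
  apply: eq_bigr => k _; have [->//|->] := (kapP k _).1 erefl.
  by rewrite normc_conjc.
rewrite (prod_places (fun i => normc (sigma i y)) sys basis kapP).
rewrite -[LHS]expRK expR_sum; congr ln; apply: eq_bigr => i _.
by rewrite log_embeddingE expRM_natl lnK // posrE normc_gt0 fmorph_eq0.
Qed.

(* The sum of the coordinates bounds the deviation from below once each is
   bounded from above. *)
Lemma log_approximation (R : realType) (K : fieldExtType rat) (r1 r2 d : nat)
    (sigma : 'I_(r1 + r2) -> {rmorphism K -> R[i]})
    (tau : 'I_d -> {rmorphism K -> R[i]}) (x : K) :
  embedding_system sigma -> power_basis tau x ->
  exists (E : R) (m0 : nat), forall v : 'rV[R]_(r1 + r2), \sum_i v 0 i = 0 ->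
    exists (a : 'rV[int]_d) (m : nat),
      [/\ int_combination x a != 0, (0 < m <= m0)%N,
          integralOver (intr : int -> K) (m%:R / int_combination x a)
        & forall i, `|log_embedding sigma (int_combination x a) 0 i - v 0 i| <= E].
Proof.
move=> sys basis; have [x_int _ _ _ _] := basis.
have [C C1 CP] := small_element sys basis.
(* The factor 2 is the largest local degree. *)
pose L := 2 * ln C; have L0 : 0 <= L by rewrite mulr_ge0 // ln_ge0.
exists ((r1 + r2)%:R * L), (Num.truncn (C ^+ d)) => v v0.
have [a [a0 sigma_le prod_le]] := CP v v0.
have a_int := int_combination_integral a x_int.
have [m [m0 mE m_int]] := norm_embeddings_nat basis a_int a0.
exists a, m; split => //.
  rewrite m0 /= truncn_ge_nat -?mE // exprn_ge0 //; lra.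
have dev_le i : log_embedding sigma (int_combination x a) 0 i - v 0 i <= L.
  rewrite log_embeddingE.
  have pos : 0 < normc (sigma i (int_combination x a)) by rewrite normc_gt0 fmorph_eq0.
  have : ln (normc (sigma i (int_combination x a))) <=
         ln C + v 0 i / (place_degree i)%:R.
    rewrite -[X in _ + X]expRK -lnM ?posrE ?expR_gt0 //; last lra.
    by rewrite ler_ln ?posrE ?mulr_gt0 ?expR_gt0 //; lra.
  have := ln_ge0 C1; rewrite /L /place_degree; case: ifP => _; lra.
have dev_sum : 0 <= \sum_i (log_embedding sigma (int_combination x a) 0 i - v 0 i).
  rewrite sumrB v0 subr0 (sum_log_embedding sys basis a0) mE.
  by rewrite ln_ge0 // ler1n.
move=> i; have s0 : (0 < r1 + r2)%N by case: (r1 + r2)%N i => [[]|].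
have sL : L <= (r1 + r2)%:R * L by rewrite ler_peMl // ler1n.
rewrite ler_norml; apply/andP; split; last exact: le_trans (dev_le i) sL.
move: dev_sum; rewrite (bigD1 i) //=.
have : \sum_(j | j != i) (log_embedding sigma (int_combination x a) 0 j - v 0 j) <=
       (r1 + r2)%:R * L.
  apply: (@le_trans _ _ (\sum_(j | j != i) L)); first by apply: ler_sum => j _.
  rewrite sumr_const -[X in X <= _]mulr_natl ler_wpM2r // ler_nat.
  by rewrite -[X in (_ <= X)%N]card_ord max_card.
lra.
Qed.

(* If [v *m f <> 0], approximate widely spaced multiples of [v] by logarithms of
   elements with bounded norm; two of them are congruent modulo their common
   norm, hence differ by a unit, whose logarithm is not orthogonal to [f]. *)
Lemma log_unit_lattice_orthogonal (R : realType) (K : fieldExtType rat)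
    (r1 r2 : nat) (sigma : 'I_(r1 + r2) -> {rmorphism K -> R[i]})
    (f : 'cV[R]_(r1 + r2)) (v : 'rV[R]_(r1 + r2)) :
  embedding_system sigma ->
  (forall w, log_unit_lattice sigma w -> w *m f = 0) ->
  \sum_i v 0 i = 0 -> v *m f = 0.
Proof.
move=> sys f_orth v_sum; have [d [tau [x basis]]] := power_basis_exists R K.
have [x_int _ _ _ _] := basis.
have [E [m0 approx]] := log_approximation sys basis.
have [b b0 bP] := mx_entry_bound f.
pose c := (v *m f) 0 0; have [c0|c0] := eqVneq c 0.
  by apply/matrixP => i j; rewrite !ord1 -/c c0 mxE.
exfalso; pose B := (r1 + r2)%:R * (E * b).
(* Paired with [f], the vector [t n *: v] gives n (2B + 1), and a logarithm within [E] of it gives a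
   value within [B] of that: distinct indices give distinct values. *)
pose t (n : nat) : R := n%:R * ((2 * B + 1) / c).
have /boolp.choice[a /boolp.choice[m amP]] : forall n : nat,
    exists (a : 'rV[int]_d) (m : nat),
      [/\ int_combination x a != 0, (0 < m <= m0)%N,
          integralOver (intr : int -> K) (m%:R / int_combination x a)
        & forall i, `|log_embedding sigma (int_combination x a) 0 i -
                      (t n *: v) 0 i| <= E].
  move=> n; apply: approx; under eq_bigr do rewrite mxE.
  by rewrite -mulr_sumr v_sum mulr0.
pose F := ('I_m0.+1 * {ffun 'I_d -> 'I_m0.+1})%type.
(* There is one more index than possible values, so two indices share [m] and all coordinates modulo
   [m]. *)
pose phi (n : 'I_#|{: F}|.+1) : F :=
  (inord (m n), [ffun j => inord (absz (modz (a n 0 j) (m n)%:Z))]).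
have [/injectiveP/leq_card|/injectivePn[n1 [n2 n12 phi12]]] := boolP (injectiveb phi).
  by rewrite card_ord ltnn.
have [a1_0 /andP[m1_0 m1_le] m1_int log1] := amP n1.
have [a2_0 /andP[m2_0 m2_le] m2_int log2] := amP n2.
have m12 : m n1 = m n2.
  by have := congr1 (fun p => nat_of_ord p.1) phi12; rewrite /= !inordK.
have dvd_a j : exists z : int, a n1 0 j - a n2 0 j = (m n1)%:Z * z.
  have mod_lt (e : int) (n : 'I_#|{: F}|.+1) : (0 < m n)%N -> (m n <= m0)%N ->
      (absz (modz e (m n)%:Z) < m0.+1)%N.
    move=> mn0 mnle; rewrite ltnS; apply: leq_trans mnle.
    have := @ltz_pmod e (m n)%:Z; have := @modz_ge0 e (m n)%:Z; lia.
  have := congr1 (fun p : F => nat_of_ord (p.2 j)) phi12.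
  rewrite /= !ffunE !inordK ?mod_lt // -m12 => eqmod.
  have : modz (a n1 0 j) (m n1)%:Z = modz (a n2 0 j) (m n1)%:Z.
    have := @modz_ge0 (a n1 0 j) (m n1)%:Z; have := @modz_ge0 (a n2 0 j) (m n1)%:Z.
    lia.
  move/eqP; rewrite eqz_mod_dvd => /dvdzP[z ->]; exists z.
  by rewrite mulrC.
have /boolp.choice[z zP] := dvd_a.
have u_unit : integer_unit (int_combination x (a n1) / int_combination x (a n2)).
  apply: (integer_unit_quotient (m := m n1) (c := int_combination x (\row_j z j))) => //.
  - by rewrite m12.
  - exact: int_combination_integral.
  rewrite -int_combinationB -[(m n1)%:R]/((m n1)%:Z%:~R) -int_combinationZ.
  by congr int_combination; apply/rowP => j; rewrite !mxE zP.
have := f_orth _ (ex_intro2 _ _ _ u_unit erefl).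
rewrite log_embeddingM ?invr_eq0 // log_embeddingV // mulmxBl => /eqP.
rewrite subr_eq0 => /eqP /(congr1 (fun A : 'M[R]_1 => A 0 0)).
have near_row (n : nat) : (forall i, `|log_embedding sigma (int_combination x (a n)) 0 i -
                      (t n *: v) 0 i| <= E) ->
    `|(log_embedding sigma (int_combination x (a n)) *m f) 0 0 - n%:R * (2 * B + 1)| <= B.
  move=> logn.
  have -> : (log_embedding sigma (int_combination x (a n)) *m f) 0 0 - n%:R * (2 * B + 1) =
    ((log_embedding sigma (int_combination x (a n)) - t n *: v) *m f) 0 0.
    rewrite mulmxBl -scalemxAl [RHS]mxE [X in _ = _ + X]mxE [X in _ = _ - X]mxE -/c.
    by rewrite /t -mulrA divfK.
  apply: mulmx_row_bound => // i.
  by rewrite mxE [X in _ + X]mxE.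
have := near_row n1 log1; have := near_row n2 log2.
move: (_ 0 0) (_ 0 0) => y1 y2 h2 h1 y12; rewrite {}y12 in h1.
have : 1 <= `|n1%:R - n2%:R : R|.
  have : 0 < `|n1%:Z - n2%:Z| by rewrite normr_gt0 subr_eq0 eqz_nat.
  rewrite gtz0_ge1 -(ler_int R) intr_norm intrB.
  by [].
have B0 : 0 <= B := le_trans (normr_ge0 _) h1.
have : `|(n1%:R - n2%:R) * (2 * B + 1)| <= 2 * B.
  rewrite mulrBl.
  have -> : n1%:R * (2 * B + 1) - n2%:R * (2 * B + 1) =
    (y2 - n2%:R * (2 * B + 1)) - (y2 - n1%:R * (2 * B + 1)) by ring.
  apply: le_trans (ler_normB _ _) _; rewrite [leRHS](_ : _ = B + B); last by ring.
  exact: lerD.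
rewrite normrM (@ger0_norm _ (2 * B + 1)); last lra.
nra.
Qed.

(** * The covering radius *)

Lemma norm_row_entry (R : realType) (n : nat) (v : 'rV[R]_n) (i : 'I_n) :
  `|v 0 i| <= `|v|.
Proof.
by rewrite [leRHS]mx_normrE; apply: (le_bigmax _ (fun ij => `|v ij.1 ij.2|) (0, i)).
Qed.

Section UnitLattice.
Variables (R : realType) (K : fieldExtType rat) (r1 r2 : nat).
Variable sigma : 'I_(r1 + r2) -> {rmorphism K -> R[i]}.

Lemma integer_unit1 : integer_unit (1 : K).
Proof. by split; rewrite ?oner_eq0 ?invr1 //; exact: integral1. Qed.

Lemma integer_unitM (y z : K) :
  integer_unit y -> integer_unit z -> integer_unit (y * z).
Proof.
move=> [y0 yi yVi] [z0 zi zVi]; split; first by rewrite mulf_neq0.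
  exact: integral_mul.
by rewrite invfM; exact: integral_mul.
Qed.

Lemma integer_unitV (y : K) : integer_unit y -> integer_unit y^-1.
Proof. by move=> [y0 yi yVi]; split; rewrite ?invr_eq0 ?invrK. Qed.

Lemma log_unit_lattice0 : log_unit_lattice sigma 0.
Proof. by exists 1; [exact: integer_unit1 | exact: log_embedding1]. Qed.

Lemma log_unit_latticeD (v w : 'rV[R]_(r1 + r2)) :
  log_unit_lattice sigma v -> log_unit_lattice sigma w ->
  log_unit_lattice sigma (v + w).
Proof.
move=> [y yu <-] [z zu <-]; exists (y * z); first exact: integer_unitM.
by apply: log_embeddingM; [case: yu | case: zu].
Qed.

Lemma log_unit_latticeN (v : 'rV[R]_(r1 + r2)) :
  log_unit_lattice sigma v -> log_unit_lattice sigma (- v).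
Proof.
move=> [y yu <-]; exists y^-1; first exact: integer_unitV.
by apply: log_embeddingV; case: yu.
Qed.

Let distances v : set R := [set `|v - w| | w in log_unit_lattice sigma]%classic.

Lemma distances_lbound v : lbound (distances v) 0.
Proof. by move=> _ [w _ <-]. Qed.

(* The covering radius is a genuine supremum: rounding coordinates in a spanning
   family of lattice vectors bounds all the distances. *)
Lemma covering_radius_ub v : real_span (log_unit_lattice sigma) v ->
  inf (distances v) <= covering_radius sigma.
Proof.
move=> v_span; apply: ub_le_sup; last by exists v.
have [X [XA AX]] := span_witness (log_unit_lattice sigma).
exists (\sum_(y <- X) `|y|) => _ [u u_span <-].
have /(real_spanP _ XA AX) uX := u_span.
have [w wA le_w] := span_round log_unit_lattice0 log_unit_latticeD
  log_unit_latticeN XA uX.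
apply: le_trans le_w; apply: ge_inf; last by exists w.
by exists 0; exact: distances_lbound.
Qed.

Lemma covering_radius_ge0 : 0 <= covering_radius sigma.
Proof.
have span0 : real_span (log_unit_lattice sigma) 0.
  by exists [::]; split => //; exact: mem0v.
apply: le_trans (covering_radius_ub span0).
apply: lb_le_inf; last exact: distances_lbound.
by eexists; exists 0; first exact: log_unit_lattice0.
Qed.

Lemma covering_radius_near v p : real_span (log_unit_lattice sigma) v ->
  covering_radius sigma < p ->
  exists2 w, log_unit_lattice sigma w & `|v - w| < p.
Proof.
move=> v_span lt_p.
have [||_ [w wA <-] vw] := @inf_lt _ (distances v) p; last by exists w.
  by eexists; exists 0; first exact: log_unit_lattice0.
exact: le_lt_trans (covering_radius_ub v_span) lt_p.
Qed.

End UnitLattice.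

(** * The regulator bound *)

Lemma log_embedding_prod (R : realType) (K : fieldExtType rat) (r1 r2 : nat)
    (sigma : 'I_(r1 + r2) -> {rmorphism K -> R[i]}) (I : finType) (f : I -> K) :
  (forall i, f i != 0) ->
  log_embedding sigma (\prod_i f i) = \sum_i log_embedding sigma (f i).
Proof.
move=> f0; suff [] : \prod_i f i != 0 /\
  log_embedding sigma (\prod_i f i) = \sum_i log_embedding sigma (f i) by [].
apply: (big_ind2 (fun y v => y != 0 /\ log_embedding sigma y = v)) => [|y v z w [y0 <-] [z0 <-]|i _].
- by rewrite oner_eq0 log_embedding1.
- by rewrite mulf_neq0 // log_embeddingM.
- by split.
Qed.

Lemma log_embeddingX (R : realType) (K : fieldExtType rat) (r1 r2 : nat)
    (sigma : 'I_(r1 + r2) -> {rmorphism K -> R[i]}) (y : K) (n : nat) :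
  y != 0 -> log_embedding sigma (y ^+ n) = log_embedding sigma y *+ n.
Proof.
move=> y0; elim: n => [|n IH]; first by rewrite log_embedding1.
by rewrite exprS log_embeddingM ?expf_neq0 // IH mulrS.
Qed.

Lemma log_embeddingXz (R : realType) (K : fieldExtType rat) (r1 r2 : nat)
    (sigma : 'I_(r1 + r2) -> {rmorphism K -> R[i]}) (y : K) (n : int) :
  y != 0 -> log_embedding sigma (y ^ n) = log_embedding sigma y *~ n.
Proof.
move=> y0; case: n => n; first exact: log_embeddingX.
by rewrite NegzE -exprnN log_embeddingV ?expf_neq0 // log_embeddingX // mulrNz.
Qed.

(** A root of unity has logarithm zero, since a positive multiple of that logarithm vanishes; only
    the powers of the fundamental units remain. *)
Lemma fundamental_units_log (R : realType) (K : fieldExtType rat) (r1 r2 : nat)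
    (sigma : 'I_(r1 + r2) -> {rmorphism K -> R[i]})
    (u : 'I_(unit_rank r1 r2) -> K) (w : 'rV[R]_(r1 + r2)) :
  fundamental_units u -> log_unit_lattice sigma w ->
  exists n : 'rV[int]_(unit_rank r1 r2),
    w = map_mx intr n *m \matrix_i log_embedding sigma (u i).
Proof.
move=> [u_unit u_gen] [y y_unit <-].
have [[z n] [[[k k0 zk] ->] _]] := u_gen y y_unit.
have u0 i : u i != 0 by case: (u_unit i).
have z0 : z != 0.
  by apply/eqP => z0; move: zk; rewrite /= z0 expr0n gtn_eqF // => /esym/eqP; rewrite oner_eq0.
have log_z : log_embedding sigma z = 0.
  have /eqP : log_embedding sigma z *+ k = 0.
    by rewrite -log_embeddingX // zk log_embedding1.
  by rewrite -scaler_nat scaler_eq0 pnatr_eq0 gtn_eqF //= => /eqP.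
have un0 i : u i ^ n i != 0 by rewrite expfz_neq0.
exists (\row_i n i); rewrite log_embeddingM //=; last by apply/prodf_neq0.
rewrite log_z add0r log_embedding_prod // mulmx_sum_row; apply: eq_bigr => i _.
by rewrite !mxE rowK log_embeddingXz // scaler_int.
Qed.

Lemma regulator_le_covering_radius (R : realType) (K : fieldExtType rat)
    (r1 r2 : nat) (sigma : 'I_(r1 + r2) -> {rmorphism K -> R[i]})
    (u : 'I_(unit_rank r1 r2) -> K) (j : 'I_(r1 + r2)) (p : R) :
  fundamental_units u -> covering_radius sigma < p ->
  regulator sigma u j <= (2 * p) ^+ unit_rank r1 r2.
Proof.
move=> u_fund lt_p; rewrite /regulator.
have p0 : 0 <= p := le_trans (covering_radius_ge0 sigma) (ltW lt_p).
pose L : 'M[R]_(unit_rank r1 r2, r1 + r2) := \matrix_i log_embedding sigma (u i).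
rewrite -/L; pose A : 'M[R]_(unit_rank r1 r2) := col' j L.
rewrite -/A; have [->|detA] := eqVneq (\det A) 0.
  by rewrite normr0 exprn_ge0 // mulr_ge0.
apply: covering_det_le => // y.
(* [v] is the point of the span of the lattice whose coordinates other than the [j]-th are those of
   [y]. *)
pose v := y *m invmx A *m L.
have v_span : real_span (log_unit_lattice sigma) v.
  exists [seq row i L | i <- enum 'I_(unit_rank r1 r2)]; split.
    move=> _ /mapP[i _ ->]; rewrite rowK; exists (u i) => //.
    by case: u_fund => u_unit _; exact: u_unit.
  rewrite /v mulmx_sum_row; apply: rpred_sum => i _; apply: rpredZ.
  by apply: memv_span; apply: map_f; rewrite mem_enum.
have [w wA vw] := covering_radius_near v_span lt_p.
have [n nE] := fundamental_units_log u_fund wA.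
exists n => k.
have <- : (v - w) 0 (lift j k) = (y - map_mx intr n *m A) 0 k.
  have Au : A \in unitmx by rewrite unitmxE unitfE.
  have colA (B : 'rV[R]_(unit_rank r1 r2)) : (B *m L) 0 (lift j k) = (B *m A) 0 k.
    by rewrite !mxE; apply: eq_bigr => i _; rewrite [in RHS]mxE.
  by rewrite nE mxE [X in _ + X]mxE /v !colA mulmxKV // [RHS]mxE [X in _ = _ + X]mxE.
exact: le_trans (norm_row_entry _ _) (ltW vw).
Qed.

Lemma covering_radius_ge_regulator (R : realType) (K : fieldExtType rat)
    (r1 r2 : nat) (sigma : 'I_(r1 + r2) -> {rmorphism K -> R[i]})
    (u : 'I_(unit_rank r1 r2) -> K) (j : 'I_(r1 + r2)) :
  (1 <= unit_rank r1 r2)%N -> fundamental_units u ->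
  2^-1 * regulator sigma u j `^ (unit_rank r1 r2)%:R^-1 <= covering_radius sigma.
Proof.
move=> r0 u_fund; rewrite leNgt; apply/negP => lt_rho.
(* The midpoint exceeds the covering radius strictly, as the previous bound requires, while 2p stays
   below the root of the regulator. *)
pose p := 2^-1 * (covering_radius sigma +
  2^-1 * regulator sigma u j `^ (unit_rank r1 r2)%:R^-1).
have := @regulator_le_covering_radius _ _ _ _ sigma u j p u_fund.
have rho0 := covering_radius_ge0 sigma.
have reg0 : 0 <= regulator sigma u j by exact: normr_ge0.
have -> : regulator sigma u j =
    (regulator sigma u j `^ (unit_rank r1 r2)%:R^-1) ^+ unit_rank r1 r2.
  rewrite -powR_mulrn ?powR_ge0 // -powRrM mulVf ?powRr1 //.
  by rewrite pnatr_eq0 -lt0n.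
move: lt_rho; rewrite /p.
move: (covering_radius sigma) rho0 (_ `^ _) (powR_ge0 (regulator sigma u j) (unit_rank r1 r2)%:R^-1).
move=> rho rho0 q q0 lt_rho le_q.
have lt_p : rho < 2^-1 * (rho + 2^-1 * q) by lra.
have := le_q lt_p; rewrite ler_pXn2r // ?nnegrE //; lra.
Qed.

(** * The uniform lower bound *)

(** The columns of [cokermx M] are linear forms that cut out the span of the lattice. Each of them
    vanishes on the lattice, hence on [v] by the orthogonality lemma. *)
Lemma real_span_hyperplane (R : realType) (K : fieldExtType rat)
    (r1 r2 : nat) (sigma : 'I_(r1 + r2) -> {rmorphism K -> R[i]})
    (v : 'rV[R]_(r1 + r2)) :
  embedding_system sigma -> \sum_i v 0 i = 0 ->
  real_span (log_unit_lattice sigma) v.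
Proof.
move=> sys v_sum; have [X [XA AX]] := span_witness (log_unit_lattice sigma).
apply/(real_spanP _ XA AX).
pose M : 'M[R]_(size X, r1 + r2) := \matrix_i X`_i.
have vM : (v <= M)%MS.
  rewrite submxE; apply/eqP/rowP => k; rewrite [RHS]mxE.
  have colM (w : 'rV[R]_(r1 + r2)) :
      w *m col k (cokermx M) = col k (w *m cokermx M) by rewrite !colE mulmxA.
  suff : v *m col k (cokermx M) = 0.
    by rewrite colM => /colP/(_ 0); rewrite [LHS]mxE [RHS]mxE.
  apply: (log_unit_lattice_orthogonal sys) => // w Aw; rewrite colM.
  suff -> : w *m cokermx M = 0 by apply/colP => i; rewrite !mxE.
  apply/eqP; rewrite -submxE; have := AX w Aw.
  rewrite -{1}[X]in_tupleE => /coord_span ->; apply: summx_sub => i _.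
  apply: scalemx_sub; have -> : (in_tuple X)`_i = row i M by rewrite rowK.
  exact: row_sub.
have [D ->] := submxP vM; rewrite mulmx_sum_row; apply: rpred_sum => i _.
by apply/rpredZ/memv_span; rewrite rowK mem_nth.
Qed.

(** The product of the absolute values over all embeddings is a positive integer, so they cannot all
    be less than 1. *)
Lemma integral_separation (R : realType) (K : fieldExtType rat)
    (r1 r2 : nat) (sigma : 'I_(r1 + r2) -> {rmorphism K -> R[i]}) (y : K) :
  embedding_system sigma -> integralOver (intr : int -> K) y -> y != 0 ->
  exists i, 1 <= normc (sigma i y).
Proof.
move=> sys y_int y0; have [d [tau [x basis]]] := power_basis_exists R K.
have [kap kapP] := place_of_embedding tau sys.
have [_ d0 _ _ _] := basis; pose k0 := Ordinal d0.
apply: contrapT => /forallNP lt1.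
have tau_lt1 k : normc (tau k y) < 1.
  rewrite ltNge; apply/negP => ge1; apply: (lt1 (kap k)).
  by have [E|E] := (kapP k _).1 erefl; move: ge1; rewrite E ?normc_conjc.
have nn k : 0 <= normc (tau k y) by case: (tau k y) => a b; apply: sqrtr_ge0.
have [m [m0 mE _]] := norm_embeddings_nat basis y_int y0.
have : \prod_k normc (tau k y) < 1.
  rewrite (bigD1 k0) //=; apply: le_lt_trans (tau_lt1 k0).
  rewrite ler_piMr //; apply: prodr_ile1 => k _.
  by rewrite nn ltW.
by rewrite mE ltrn1 ltnNge m0.
Qed.

(** All coordinates but the first run through a grid of mesh 2c, and the first makes the sum zero.
    Grid points have disjoint open balls of radius c, so nearby elements of [A] are distinct. The
    first coordinate may be very negative, but only an upper bound is claimed. *)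
Lemma hyperplane_grid (R : realType) (n M : nat) (A : set 'rV[R]_n) (c : R) :
  (0 < n)%N -> 0 < c ->
  (forall v : 'rV[R]_n, \sum_i v 0 i = 0 -> exists2 w, A w & `|v - w| < c) ->
  exists2 f : {ffun 'I_n.-1 -> 'I_M.+1} -> 'rV[R]_n, injective f &
    forall a, A (f a) /\ forall i, f a 0 i <= (2 * M)%:R * c + c.
Proof.
have lt_grid (p q z : R) : p - z < c -> - c < q - z -> p < q + 2 * c by lra.
case: n A => // n A _ c0 cov.
pose v (a : {ffun 'I_n -> 'I_M.+1}) : 'rV[R]_n.+1 :=
  \row_i (if unlift ord0 i is Some j then (2 * a j)%:R * c
          else - \sum_j (2 * a j)%:R * c).
have v_lift a j : v a 0 (lift ord0 j) = (2 * a j)%:R * c by rewrite mxE liftK.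
have v_sum a : \sum_i v a 0 i = 0.
  rewrite big_ord_recl mxE unlift_none.
  by rewrite (eq_bigr _ (fun j _ => v_lift a j)) addNr.
have /boolp.choice[f fP] : forall a, exists w, A w /\ `|v a - w| < c.
  by move=> a; have [w Aw vw] := cov _ (v_sum a); exists w.
have f_near a i : `|v a 0 i - f a 0 i| < c.
  have [_ vw] := fP a; apply: le_lt_trans vw.
  by have := norm_row_entry (v a - f a) i; rewrite [X in `|X| <= _]mxE [X in _ + X]mxE.
exists f => [a b fab|a].
  apply/ffunP => j; apply/val_inj => /=.
  have := f_near a (lift ord0 j); have := f_near b (lift ord0 j).
  rewrite fab !v_lift; move: (f b 0 _) => z.
  rewrite !ltr_norml => /andP[h1 h2] /andP[h3 h4].
  have : (2 * a j)%:R * c < (2 * b j + 2)%:R * c by rewrite natrD mulrDl (lt_grid _ _ z).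
  have : (2 * b j)%:R * c < (2 * a j + 2)%:R * c by rewrite natrD mulrDl (lt_grid _ _ z).
  rewrite !ltr_pM2r // !ltr_nat; move: (nat_of_ord (a j)) (nat_of_ord (b j)) => p q.
  lia.
split; first by case: (fP a).
move=> i; have : f a 0 i <= v a 0 i + c.
  by have := f_near a i; rewrite ltr_norml => /andP[]; lra.
move/le_trans; apply; rewrite lerD2r mxE; case: unliftP => [j _|_].
  by rewrite ler_pM2r // ler_nat leq_mul2l /= -ltnS.
apply: (@le_trans _ _ 0); last by rewrite mulr_ge0 // ltW.
by rewrite oppr_le0 sumr_ge0 // => j _; rewrite mulr_ge0 // ltW.
Qed.

Lemma normc_ge_ReIm (R : realType) (z : R[i]) :
  `|complex.Re z| <= normc z /\ `|complex.Im z| <= normc z.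
Proof.
case: z => a b /=; rewrite -!sqrtr_sqr.
by split; rewrite ler_wsqrtr // ?lerDl ?lerDr sqr_ge0.
Qed.

(** The shift by 2 makes the arguments nonnegative, and the factor 2 makes the cells half a unit
    long. *)
Lemma truncn_eq_dist (R : realType) (s t : R) :
  `|s| <= 2 -> `|t| <= 2 ->
  Num.truncn (2 * (s + 2)) = Num.truncn (2 * (t + 2)) -> `|s - t| < 2^-1.
Proof.
rewrite !ler_norml => /andP[s1 _] /andP[t1 _] st.
have s0 : 0 <= 2 * (s + 2) by lra.
have t0 : 0 <= 2 * (t + 2) by lra.
have := truncn_itv s0; have := truncn_itv t0; rewrite st.
move: (Num.truncn _) => m; rewrite -[m.+1%:R]natr1 => /andP[h1 h2] /andP[h3 h4].
by rewrite ltr_norml; apply/andP; split; lra.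
Qed.

Lemma normc_box (R : realType) (z w : R[i]) :
  normc z <= 2 -> normc w <= 2 ->
  Num.truncn (2 * (complex.Re z + 2)) = Num.truncn (2 * (complex.Re w + 2)) ->
  Num.truncn (2 * (complex.Im z + 2)) = Num.truncn (2 * (complex.Im w + 2)) ->
  normc (z - w) < 1.
Proof.
move=> z2 w2 eqRe eqIm.
have [Rz Iz] := normc_ge_ReIm z; have [Rw Iw] := normc_ge_ReIm w.
have := truncn_eq_dist (le_trans Rz z2) (le_trans Rw w2) eqRe.
have := truncn_eq_dist (le_trans Iz z2) (le_trans Iw w2) eqIm.
case: z w {z2 w2 eqRe eqIm Rz Iz Rw Iw} => [a b] [a' b'] /=.
rewrite !ltr_norml => /andP[h1 h2] /andP[h3 h4].
rewrite -[ltRHS]sqrtr1 ltr_sqrt //.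
nra.
Qed.

(* Integers of [K] with all absolute values at most [2] fall into [9 ^ 2] boxes
   of diameter [< 1] at each place, and no two of them in the same boxes. *)
Lemma covering_radius_ge_const (R : realType) (K : fieldExtType rat)
    (r1 r2 : nat) (sigma : 'I_(r1 + r2) -> {rmorphism K -> R[i]}) :
  embedding_system sigma -> (1 <= unit_rank r1 r2)%N ->
  ln 2 / (2 * 9 ^ 4 + 1)%:R <= covering_radius sigma.
Proof.
move=> sys r0; rewrite leNgt; apply/negP => lt_rho.
(* [M] is 81 ^ 2, so that 81 ^ (r + 1) is at most M ^ r for r >= 1, less than the number (M + 1) ^ r
   of units found. *)
set c := ln 2 / _ in lt_rho; set M := (9 ^ 4)%N in c lt_rho.
have M0 : 0 < (2 * M + 1)%:R :> R by rewrite ltr0n addn1.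
have ln2 : 0 < ln 2 :> R by rewrite ln_gt0 //; lra.
have c0 : 0 < c by rewrite divr_gt0.
have s0 : (0 < r1 + r2)%N by move: r0; rewrite /unit_rank; case: (r1 + r2)%N.
have [v v_sum|f f_inj fP] :=
    @hyperplane_grid _ _ M (log_unit_lattice sigma) c s0 c0.
  exact: covering_radius_near (real_span_hyperplane sys v_sum) lt_rho.
have /boolp.choice[y yP] : forall a, exists y : K,
    integer_unit y /\ log_embedding sigma y = f a.
  by move=> a; have [[y y_unit yE] _] := fP a; exists y.
have y_le a i : normc (sigma i (y a)) <= 2.
  have [[y0 _ _] yE] := yP a.
  have pos : 0 < normc (sigma i (y a)) by rewrite normc_gt0 fmorph_eq0.
  have [_ /(_ i)] := fP a; rewrite -yE log_embeddingE.
  (* [c] is chosen so that the upper bound on the grid is exactly ln 2; at a complex place, where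
     the logarithm is doubled, this still bounds the absolute value by 2. *)
  have -> : (2 * M)%:R * c + c = ln 2.
    by rewrite -[X in _ + X]mul1r -mulrDl natr1 -addn1 mulrC divfK // gt_eqF.
  move=> le_ln2; rewrite -ler_ln ?posrE //.
  by move: le_ln2; rewrite /place_degree; case: ifP => _; lra.
(* The argument ranges over [0, 8] with both ends allowed, hence 9 cells for each real
   coordinate. *)
have box_lt (t : R) : `|t| <= 2 -> (Num.truncn (2 * (t + 2)) < 9)%N.
  by rewrite ler_norml => /andP[h1 h2]; rewrite truncn_lt_nat; lra.
have entry_le (z : R[i]) : normc z <= 2 -> `|complex.Re z| <= 2 /\ `|complex.Im z| <= 2.
  by have [Rz Iz] := normc_ge_ReIm z => z2; split; [exact: le_trans Rz z2 | exact: le_trans Iz z2].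
pose phi a : {ffun 'I_(r1 + r2) -> 'I_9 * 'I_9} := [ffun i =>
  (inord (Num.truncn (2 * (complex.Re (sigma i (y a)) + 2))),
   inord (Num.truncn (2 * (complex.Im (sigma i (y a)) + 2))))].
have [/injectiveP/leq_card|/injectivePn[a [b ab phi_ab]]] := boolP (injectiveb phi).
  rewrite !card_ffun card_prod !card_ord => le1.
  have : ((9 * 9) ^ (r1 + r2) <= M ^ unit_rank r1 r2)%N.
    rewrite /M (_ : 9 ^ 4 = (9 * 9) ^ 2)%N // -expnM leq_exp2l //.
    by move: r0; rewrite /unit_rank; lia.
  move/(leq_trans le1); rewrite /unit_rank leq_exp2r ?ltnn //.
have [[ya0 ya_int _] yaE] := yP a; have [[yb0 yb_int _] ybE] := yP b.
have yab : y a - y b != 0.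
  rewrite subr_eq0; apply: contraNneq ab => yab; apply/eqP/f_inj.
  by rewrite -yaE -ybE yab.
have [k] := integral_separation sys (integral_sub ya_int yb_int) yab.
rewrite rmorphB leNgt => /negP; apply; apply: normc_box => //.
  have := congr1 (fun p : {ffun 'I_(r1 + r2) -> 'I_9 * 'I_9} => nat_of_ord (p k).1) phi_ab.
  have [ha _] := entry_le _ (y_le a k); have [hb _] := entry_le _ (y_le b k).
  by rewrite /= !ffunE /= !inordK ?box_lt.
have := congr1 (fun p : {ffun 'I_(r1 + r2) -> 'I_9 * 'I_9} => nat_of_ord (p k).2) phi_ab.
have [_ ha] := entry_le _ (y_le a k); have [_ hb] := entry_le _ (y_le b k).
by rewrite /= !ffunE /= !inordK ?box_lt.
Qed.

Theorem theorem3p4 (R : realType) :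
  (forall (K : fieldExtType rat) (r1 r2 : nat)
      (sigma : 'I_(r1 + r2) -> {rmorphism K -> R[i]}),
    embedding_system sigma -> (1 <= unit_rank r1 r2)%N ->
    forall (u : 'I_(unit_rank r1 r2) -> K) (j : 'I_(r1 + r2)),
      fundamental_units u ->
      2^-1 * regulator sigma u j `^ (unit_rank r1 r2)%:R^-1
        <= covering_radius sigma)
  /\
  (exists2 c : R, 0 < c &
    forall (K : fieldExtType rat) (r1 r2 : nat)
      (sigma : 'I_(r1 + r2) -> {rmorphism K -> R[i]}),
      embedding_system sigma -> (1 <= unit_rank r1 r2)%N ->
      c <= covering_radius sigma).
Proof.
split=> [K r1 r2 sigma _ r0 u j u_fund|].
  exact: covering_radius_ge_regulator.
exists (ln 2 / (2 * 9 ^ 4 + 1)%:R) => [|K r1 r2 sigma sys r0].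
  by apply: divr_gt0; [rewrite ln_gt0 //; lra | rewrite ltr0n addn1].
exact: covering_radius_ge_const.
Qed.
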